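(* Let $d\ge 1$ and let $f_1,f_2,f_3$ be generic polynomials of degree $d$ in two variables with homogenizations $F_1,F_2,F_3$. Up to ordering of rows and columns (and identifying a monomial of degree at most $2d-2$ in $X_1,X_2$ with its homogenization of degree $2d-2$ in $X_1,X_2,X_3$), the ''affine'' Dixon matrix $M$ of $f_1,f_2,f_3$ and the ''homogeneous'' matrix ${}^{\mathbf t}M_{2d-2}$ (the transpose of the matrix $M_{2d-2}$ associated with $F_1,F_2,F_3$) coincide.
   Context: Let $f_1,f_2,f_3$ be polynomials in $(X_1,X_2)$ having all monomials of degree at most $d$, with independent indeterminate coefficients, and $A$ the polynomial ring over $\mathbb{Z}$ in these coefficients. Let $F_i(X_1,X_2,X_3)$ be the homogenization of $f_i$ in degree $d$ with homogenizing variable $X_3$. Affine Dixon matrix $M$. Let $\mathrm{Bez}(X_1,X_2,Y_1,Y_2)$ be the polynomial obtained by dividing $$\det\begin{pmatrix} f_1(X_1,X_2)&f_2(X_1,X_2)&f_3(X_1,X_2)\\ f_1(Y_1,X_2)&f_2(Y_1,X_2)&f_3(Y_1,X_2)\\ f_1(Y_1,Y_2)&f_2(Y_1,Y_2)&f_3(Y_1,Y_2)\end{pmatrix}$$ by $(X_1-Y_1)(X_2-Y_2)$, and write $\mathrm{Bez}=\sum_{|\beta|\le 2d-2}B_\beta(X_1,X_2)Y_1^{\beta_1}Y_2^{\beta_2}$. Let $\mathcal{B}$ be the set of monomials in $X_1,X_2$ of degree $\le d-2$ and $\mathcal{C}$ the set of monomials in $X_1,X_2$ of degree $\le 2d-2$.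 $M$ is the square matrix of size $2d^2-d$ whose columns are indexed by $\mathcal{C}$ and whose rows contain consecutively the expansions in the basis $\mathcal{C}$ of $m\cdot f_1$, of $m\cdot f_2$, of $m\cdot f_3$ ($m\in\mathcal{B}$), and finally the expansions of all $B_\beta$ with $|\beta|\le d-1$. Homogeneous matrix. Here $n=3$, $d_1=d_2=d_3=d$, $t_3=3d-3$. Put, for $X=(X_1,X_2,X_3)$, $Y=(Y_1,Y_2,Y_3)$, $$\Delta_{ij}(X,Y)=\frac{F_i(Y_1,\dots,Y_{j-1},X_j,\dots,X_3)-F_i(Y_1,\dots,Y_j,X_{j+1},\dots,X_3)}{X_j-Y_j},$$ $$\Delta(X,Y)=\det(\Delta_{ij})_{1\le i,j\le 3}=\sum_{|\gamma|\le 3d-3}\Delta_\gamma(X)Y^\gamma .$$ Let $S_u$ be the free $A$-module on monomials of degree $u$ in $X_1,X_2,X_3$ ($S_u=0$ for $u<0$) and $\{T_\gamma\}$ the basis dual to the monomial basis. In general, for an integer $t$, $M_t$ is the matrix in the monomial (and dual monomial) bases of the map $$S_{t_3-t}^*\oplus\bigoplus_{j=1}^3S^{t,j}\to S_t\oplus\Big(\bigoplus_{j=1}^3S^{t_3-t,j}\Big)^*,$$ $$(T,g)\mapsto(\psi_{1,t}(T)+\textstyle\sum_jg_jF_j,\ \psi_{2,t_3-t}^*(T)),$$ where $S^{t,j}=\langle X^\gamma:|\gamma|=t-d,\ \gamma_i<d\ \text{for } i<j\rangle$, $\psi_{1,t}(T_\gamma)=\Delta_\gamma(X)$ and $\psi_{2,u}:\bigoplus_jS^{u,j}\to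 S_u$, $(g_j)\mapsto\sum g_jF_j$. For $t=2d-2$ one has $S^{t,j}=S_{d-2}$ for $j=1,2,3$ and $S^{t_3-t,j}=0$, so $M_{2d-2}$ is the matrix of $S_{d-1}^*\oplus S_{d-2}^{3}\to S_{2d-2}$, $(T,g)\mapsto\psi_{1,2d-2}(T)+\sum g_jF_j$. *)

(* Defs.v *)
From HB Require Import structures.
From mathcomp Require Import all_boot all_order all_algebra zify ring.
From mathcomp.multinomials Require Import mpoly.
From Stdlib Require Import ClassicalEpsilon.

Set Implicit Arguments.
Unset Strict Implicit.
Unset Printing Implicit Defensive.

Import GRing.Theory.
Local Open Scope ring_scope.

(* The quotient of an exact division; unspecified when q does not divide p. *)
Definition mdiv (R : idomainType) (p q : R) : R :=
  epsilon (inhabits 0) (fun r => p = r * q).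

Lemma mdivK (R : idomainType) (q r : R) : q != 0 -> mdiv (r * q) q = r.
Proof.
move=> q0; have E : exists r', r * q = r' * q by exists r.
have := epsilon_spec (inhabits 0) _ E; rewrite -/(mdiv _ _).
by move/(mulIf q0).
Qed.

(* The variables X_1, ..., X_n are the elements 'X_k of {mpoly R[n]} with k
   counted from 0.  Polynomials in (X, Y) are polynomials in Y over R[X], so
   that the coefficient at Y^b of such a Q is the polynomial Q@_b in X. *)

Definition varX (R : idomainType) n (k : 'I_n) : {mpoly {mpoly R[n]}[n]} :=
  ('X_k)%:MP.

Definition varY (R : idomainType) n (k : 'I_n) : {mpoly {mpoly R[n]}[n]} :=
  'X_k.

(* p(Y_1, ..., Y_j, X_{j+1}, ..., X_n) *)
Definition hybrid (R : idomainType) n (j : nat) (p : {mpoly R[n]}) :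
    {mpoly {mpoly R[n]}[n]} :=
  mmap (fun a : R => (a%:MP)%:MP)
       (fun k : 'I_n => if (k < j)%N then varY R k else varX R k) p.

Definition homog_mon (d : nat) (m : 'X_{1..2}) : 'X_{1..3} :=
  [multinom of [:: m ord0; m ord_max; (d - mdeg m)%N]].

Definition homogenize (R : idomainType) (d : nat) (p : {mpoly R[2]}) :
    {mpoly R[3]} :=
  \sum_(m <- msupp p) p@_m *: 'X_[homog_mon d m].

Section Generic.
Variable d : nat.

(* One indeterminate coefficient for each of the three polynomials and each
   monomial of degree at most d. *)
Definition coef_index : finType := ('I_3 * 'X_{1..2 < d.+1})%type.

Definition genA : idomainType := {mpoly int[#|coef_index|]}.

Definition gen_coef (i : 'I_3) (m : 'X_{1..2 < d.+1}) : genA :=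
  'X_(enum_rank ((i, m) : coef_index)).

Definition gen_f (i : 'I_3) : {mpoly genA[2]} :=
  \sum_(m : 'X_{1..2 < d.+1}) gen_coef i m *: 'X_[m].

Definition gen_F (i : 'I_3) : {mpoly genA[3]} := homogenize d (gen_f i).

Definition Bez : {mpoly {mpoly genA[2]}[2]} :=
  mdiv (\det (\matrix_(r < 3, i < 3) hybrid r (gen_f i)))
       (\prod_(k < 2) (varX genA k - varY genA k)).

(* For 0 < d, 'X_{1..2 < d.-1}, 'X_{1..2 < (2 * d).-1} and 'X_{1..2 < d} are
   the monomials of degree <= d - 2, <= 2d - 2 and <= d - 1; the first of these
   is empty when d = 1. *)
Definition affine_rows : seq {mpoly genA[2]} :=
  [seq 'X_[val m] * gen_f i | i <- enum 'I_3, m <- enum {: 'X_{1..2 < d.-1}}]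
  ++ [seq Bez@_(val b) | b <- enum {: 'X_{1..2 < d}}].

Definition affine_cols : seq 'X_{1..2} :=
  [seq val m | m <- enum {: 'X_{1..2 < (2 * d).-1}}].

(* The sizes of affine_rows and affine_cols are computed in size_affine_rows
   and size_affine_cols, so that no default value of nth is used. *)
Definition affine_dixon_mx : 'M[genA]_(2 * d ^ 2 - d)%N :=
  \matrix_(r, c) (nth 0 affine_rows r)@_(nth 0%MM affine_cols c).

Definition Delta_ij (i j : 'I_3) : {mpoly {mpoly genA[3]}[3]} :=
  mdiv (hybrid j (gen_F i) - hybrid j.+1 (gen_F i))
       (varX genA j - varY genA j).

Definition Delta : {mpoly {mpoly genA[3]}[3]} :=
  \det (\matrix_(i < 3, j < 3) Delta_ij i j).

Definition t3 : int := (3 * d)%N%:Z - 3.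

(* The monomial basis of S_u, which is empty for u < 0. *)
Definition mon (u : int) : finType :=
  {m : 'X_{1..3 < `|u|.+1} | (mdeg m)%:Z == u}.

Definition mon_val (u : int) (m : mon u) : 'X_{1..3} := val (val m).

(* The monomial basis of the direct sum of the S^{t,j}: the pair (j, X^g)
   stands for X^g in the j-th summand. *)
Definition smon (t : int) : finType :=
  {x : 'I_3 * mon (t - d%:Z) |
    [forall i : 'I_3, (i < x.1)%N ==> (mon_val x.2 i < d)%N]}.

(* Elements of S_u^*, resp. of the direct sum of the S^{t,j}, in coordinates. *)
Definition dualS (u : int) : Type := {ffun mon u -> genA}.
Definition sumS (t : int) : Type := {ffun smon t -> genA}.

Definition dual_eval (u : int) (T : dualS u) (p : {mpoly genA[3]}) : genA :=
  \sum_(m : mon u) T m * p@_(mon_val m).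

Definition component (t : int) (g : sumS t) (j : 'I_3) : {mpoly genA[3]} :=
  \sum_(x : smon t | (val x).1 == j) g x *: 'X_[mon_val (val x).2].

Definition psi1 (t : int) (T : dualS (t3 - t)) : {mpoly genA[3]} :=
  \sum_(m : mon (t3 - t)) T m *: Delta@_(mon_val m).

Definition psi2 (u : int) (g : sumS u) : {mpoly genA[3]} :=
  \sum_(j < 3) component g j * gen_F j.

Definition psi2_dual (u : int) (T : dualS u) : sumS u -> genA :=
  fun g => dual_eval T (psi2 g).

Definition Psi (t : int) (v : dualS (t3 - t) * sumS t) :
    {mpoly genA[3]} * (sumS (t3 - t) -> genA) :=
  (psi1 v.1 + psi2 v.2, psi2_dual v.1).

Definition source_index (t : int) : finType := (mon (t3 - t) + smon t)%type.
Definition target_index (t : int) : finType := (mon t + smon (t3 - t))%type.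

Definition delta_fun (I : finType) (x : I) : {ffun I -> genA} :=
  [ffun y => (y == x)%:R].

Definition source_basis (t : int) (s : source_index t) :
    dualS (t3 - t) * sumS t :=
  match s with
  | inl m => (delta_fun m, [ffun=> 0])
  | inr x => ([ffun=> 0], delta_fun x)
  end.

Definition target_coord (t : int)
    (w : {mpoly genA[3]} * (sumS (t3 - t) -> genA)) (s : target_index t) :
    genA :=
  match s with
  | inl m => w.1@_(mon_val m)
  | inr x => w.2 (delta_fun x)
  end.

(* Column convention: the columns are the images of the basis vectors. *)
Definition homog_mx (t : int) :
    'M[genA]_(#|target_index t|, #|source_index t|) :=
  \matrix_(r, c) target_coord (Psi (source_basis (enum_val c))) (enum_val r).

End Generic.

(* The divisions defining Bez and Delta_ij are exact. *)
Lemma hybrid_dvd (R : idomainType) n (p : {mpoly R[n]}) (j : 'I_n) :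
  exists q, hybrid j p - hybrid j.+1 p = q * (varX R j - varY R j).
Proof.
pose f (a : R) : {mpoly {mpoly R[n]}[n]} := (a%:MP)%:MP.
pose h (k : nat) := fun i : 'I_n => if (i < k)%N then varY R i else varX R i.
have E k : hybrid k p = \sum_(m <- msupp p) f p@_m * mmap1 (h k) m by [].
suff H m : exists q, mmap1 (h j) m - mmap1 (h j.+1) m = q * (varX R j - varY R j).
  pose Q m := proj1_sig (constructive_indefinite_description _ (H m)).
  have HQ m := proj2_sig (constructive_indefinite_description _ (H m)).
  exists (\sum_(m <- msupp p) f p@_m * Q m).
  rewrite !E -sumrB mulr_suml; apply: eq_bigr => m _.
  by rewrite -mulrBr HQ mulrA.
rewrite /mmap1 (bigD1 j) //= [X in _ - X](bigD1 j) //=.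
rewrite [X in _ - _ * X](eq_bigr (fun i => h j i ^+ m i)); last first.
  move=> i ij; congr (_ ^+ _); rewrite /h ltnS leq_eqVlt.
  by rewrite (_ : (i == j :> nat) = false) //; apply/negbTE.
rewrite -mulrBl {1 2}/h ltnn ltnSn subrXX -mulrA mulrC.
by eexists.
Qed.

Lemma varXY_neq0 (R : idomainType) n (k : 'I_n) : varX R k - varY R k != 0.
Proof.
apply/eqP => /(congr1 (mcoeff U_(k)%MM)).
rewrite mcoeffB mcoeffC mcoeffX mcoeff0 eqxx mnm1_eq0 mulr0 sub0r => /eqP.
by rewrite oppr_eq0 oner_eq0.
Qed.

Lemma Delta_ijE d (i j : 'I_3) :
  hybrid j (gen_F d i) - hybrid j.+1 (gen_F d i) =
  Delta_ij d i j * (varX (genA d) j - varY (genA d) j).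
Proof.
rewrite /Delta_ij; have [q ->] := hybrid_dvd (gen_F d i) j.
by rewrite mdivK // varXY_neq0.
Qed.

Lemma det3_telescope (R : comNzRingType) (f : nat -> 'I_3 -> R)
    (a b : 'I_3 -> R) u v :
  (forall i, f 0 i = f 1 i + a i * u) -> (forall i, f 1 i = f 2 i + b i * v) ->
  \det (\matrix_(r < 3, i < 3) f r i) =
  \det (\matrix_(r < 3, i < 3)
          if (r == 0 :> nat) then a i else if (r == 1 :> nat) then b i
          else f 2 i) * u * v.
Proof.
move=> H0 H1.
pose g r (k : nat) := f r (inord k); pose a' (k : nat) := a (inord k).
pose b' (k : nat) := b (inord k).
have Ef r i : f r i = g r i by rewrite /g inord_val.
have Ea i : a i = a' i by rewrite /a' inord_val.
have Eb i : b i = b' i by rewrite /b' inord_val.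
rewrite !(expand_det_row _ ord0) !big_ord_recl !big_ord0 /cofactor.
rewrite !(expand_det_row _ ord0) !big_ord_recl !big_ord0 /cofactor !det_mx11.
rewrite !mxE /= /bump /= !H0 !H1 !Ef !Ea !Eb /= /bump /=.
ring.
Qed.

Lemma BezE d :
  \det (\matrix_(r < 3, i < 3) hybrid r (gen_f d i)) =
  Bez d * \prod_(k < 2) (varX (genA d) k - varY (genA d) k).
Proof.
rewrite /Bez; set D := \det _; set u := fun k : 'I_2 => varX (genA d) k - varY (genA d) k.
suff [q ->] : exists q, D = q * \prod_k u k.
  by rewrite mdivK //; apply/prodf_neq0 => k _; apply: varXY_neq0.
have H (k : 'I_2) (i : 'I_3) : {q | hybrid k (gen_f d i) = hybrid k.+1 (gen_f d i) + q * u k}.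
  apply: constructive_indefinite_description.
  have [q Hq] := hybrid_dvd (gen_f d i) k.
  by exists q; rewrite -Hq addrC subrK.
pose q k i := sval (H k i).
have Hq (k : 'I_2) i : hybrid k (gen_f d i) = hybrid k.+1 (gen_f d i) + q k i * u k := svalP (H k i).
exists (\det (\matrix_(r < 3, i < 3)
  if (r == 0 :> nat) then q ord0 i else if (r == 1 :> nat) then q ord_max i
  else hybrid 2 (gen_f d i))).
rewrite big_ord_recl big_ord1.
have -> : lift ord0 ord0 = ord_max :> 'I_2 by exact/val_inj.
rewrite mulrA.
exact: (det3_telescope (f := fun r i => hybrid r (gen_f d i))
  (Hq ord0) (Hq ord_max)).
Qed.

Lemma card_bmultinom2 b : (#|{: 'X_{1..2 < b}}| * 2 = b * b.+1)%N.
Proof.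
pose P (x : 'I_b * 'I_b) := (x.1 + x.2 < b)%N.
have deg2 (m : 'X_{1..2}) : mdeg m = (m ord0 + m ord_max)%N.
  by rewrite mdegE !big_ord_recl big_ord0 addn0; congr (_ + m _)%N; apply/val_inj.
have lt0 (m : 'X_{1..2 < b}) : (m ord0 < b)%N.
  by have := bmdeg m; rewrite deg2; lia.
have lt1 (m : 'X_{1..2 < b}) : (m ord_max < b)%N.
  by have := bmdeg m; rewrite deg2; lia.
pose h (m : 'X_{1..2 < b}) := (Ordinal (lt0 m), Ordinal (lt1 m)).
have hinj : injective h.
  move=> m1 m2 [e0 e1]; apply/val_inj/mnmP=> i.
  have [->|->] : i = ord0 \/ i = ord_max; [|exact: e0|exact: e1].
  by case: i => [[|[|k]] p] //; [left|right]; apply/val_inj.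
have him : [set h m | m : 'X_{1..2 < b}] = [set x | P x].
  apply/setP=> x; rewrite inE; apply/imsetP/idP=> [[m _ ->]|Px].
    by rewrite /P /= -deg2 bmdeg.
  pose n0 : 'X_{1..2} := [multinom of [:: val x.1; val x.2]].
  have dn : (mdeg n0 < b)%N by rewrite deg2 !multinomE !(tnth_nth 0%N).
  exists (BMultinom dn) => //.
  rewrite /h [LHS]surjective_pairing; congr (_, _); apply/val_inj;
    by rewrite /= multinomE (tnth_nth 0%N).
have -> : #|{: 'X_{1..2 < b}}| = (\sum_(i < b) (b - i))%N.
  rewrite -(card_imset _ hinj) him cardsE -sum1_card.
  rewrite (eq_bigl (fun x : 'I_b * 'I_b => true && (x.1 + x.2 < b)%N)) //.
  rewrite -(pair_big_dep xpredT (fun i j : 'I_b => (i + j < b)%N)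
              (fun _ _ => 1%N)) /=.
  apply: eq_bigr => i _.
  rewrite (eq_bigl (fun j : 'I_b => (j < b - i)%N)); last by move=> j; lia.
  rewrite -(big_ord_widen b (fun=> 1%N)) ?leq_subr //.
  by rewrite sum1_card card_ord.
elim: b {P deg2 lt0 lt1 h hinj him} => [|b IH]; first by rewrite big_ord0.
rewrite big_ord_recl subn0 (eq_bigr (fun i : 'I_b => (b - i)%N)) //.
by rewrite mulnDl IH; lia.
Qed.

Lemma size_affine_rows d : (0 < d)%N -> size (affine_rows d) = (2 * d ^ 2 - d)%N.
Proof.
case: d => // d _; rewrite /affine_rows size_cat size_allpairs size_enum_ord.
rewrite [X in (_ + X)%N]size_map -!cardE.

move: (card_bmultinom2 d) (card_bmultinom2 d.+1) => /=.
move: #|_| #|_| => a b; rewrite -mulnn; nia.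
Qed.

Lemma size_affine_cols d : (0 < d)%N -> size (affine_cols d) = (2 * d ^ 2 - d)%N.
Proof.
case: d => // d _; rewrite /affine_cols size_map -cardE.
move: (card_bmultinom2 (2 * d.+1).-1); move: #|_| => a; rewrite -mulnn; nia.
Qed.

(* Main.v *)
Require Import Defs.
From mathcomp Require Import all_boot all_order all_algebra.
From mathcomp.multinomials Require Import mpoly.
From HB Require Import structures.
From mathcomp Require Import all_fingroup zify.

(** Write u_j = X_j - Y_j, H_r for the row of the F_i evaluated at
    (Y_1, ..., Y_r, X_{r+1}, ..., X_3), and a_j for the row of the Delta_ij,
    so that H_{j-1} = H_j + u_j a_j.  Setting X_3 = 1 turns H_0, H_1, H_2 into
    the three rows of the determinant that defines Bez, hence (row operations,
    and cancellation of u_1 u_2)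
      Bez = det (a_1, a_2, H_2) = Delta (1 - Y_3) + det (a_1, a_2, H_3).
    The row H_3 consists of the F_i(Y), which are homogeneous of degree d in Y,
    so the last determinant does not contribute to the coefficient of Y^g when
    |g| < d.  As Bez does not involve Y_3, comparing coefficients gives, by
    induction on k, that Delta_(b, k)(X_1, X_2, 1) = B_b(X_1, X_2) for
    |b| + k < d (dehom_coef_Delta).

    On the other hand Delta is homogeneous of degree 3d - 3 in (X, Y)
    (Delta_bihomog), so that Delta_g is homogeneous of degree 2d - 2 in X when
    |g| = d - 1, and a homogeneous polynomial has the same coefficients as its
    dehomogenization (dehom_coef).  This identifies the Dixon rows B_b with the
    images of the dual basis vectors T_g (coef_Delta); the same remark about
    dehomogenization identifies the rows m f_i with the images m F_i.  What
    remains is to list the row and column indices of both matrices in the same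
    order.

    The identity on Delta and Bez is proved over an arbitrary integral domain R
    for any three polynomials of degree at most d, the quotients Bez and
    Delta_ij being only known through the products that define them. *)

Set Implicit Arguments.
Unset Strict Implicit.
Unset Printing Implicit Defensive.

Import GRing.Theory.
Local Open Scope ring_scope.

(** * Homogeneity in two groups of variables *)

Section Bihomogeneous.
Variables (R : idomainType) (n : nat).
Implicit Types (P Q : {mpoly {mpoly R[n]}[n]}) (p : {mpoly R[n]}).

(** Q is homogeneous of degree D in X and Y together; the zero polynomial is so
    for every D. *)
Definition bihomog (D : nat) Q :=
  forall b a, Q@_b@_a != 0 -> (mdeg a + mdeg b = D)%N.

Lemma bihomogN D Q : bihomog D Q -> bihomog D (- Q).
Proof. by move=> hQ b a; rewrite !mcoeffN oppr_eq0; apply: hQ. Qed.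

Lemma sumr_neq0 (V : zmodType) (I : Type) (r : seq I) (P : pred I) (F : I -> V) :
  \sum_(i <- r | P i) F i != 0 -> exists2 i, P i & F i != 0.
Proof.
elim/big_rec: _ => [|i x Pi IH]; first by rewrite eqxx.
by have [->|Fi0 _] := eqVneq (F i) 0; [rewrite add0r | exists i].
Qed.

Lemma bihomog_sum D (I : Type) (r : seq I) (P : pred I) F :
  (forall i, P i -> bihomog D (F i)) -> bihomog D (\sum_(i <- r | P i) F i).
Proof.
move=> hF b a; rewrite !raddf_sum => /sumr_neq0[i Pi].
exact: hF.
Qed.

Lemma bihomogM D E P Q : bihomog D P -> bihomog E Q -> bihomog (D + E) (P * Q).
Proof.
move=> hP hQ b a; rewrite mcoeffM raddf_sum => /sumr_neq0[[b1 b2] /= /eqP Eb].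
rewrite mcoeffM => /sumr_neq0[[a1 a2] /= /eqP Ea].
rewrite mulf_eq0 negb_or => /andP[/hP <- /hQ <-].
by have := congr1 mdeg Ea; have := congr1 mdeg Eb; rewrite !mdegD /=; lia.
Qed.

Lemma bihomogC c : bihomog 0 ((c%:MP)%:MP).
Proof.
move=> b a; rewrite !mcoeffC; case: (b =P 0%MM) => [->|_]; last first.
  by rewrite mulr0 mcoeff0 eqxx.
rewrite mulr1 mcoeffC; case: (a =P 0%MM) => [->|_]; last by rewrite mulr0 eqxx.
by rewrite !mdeg0.
Qed.

Lemma bihomog1 : bihomog 0 1.
Proof. by rewrite -mpolyC1 -mpolyC1; exact: bihomogC. Qed.

Lemma bihomog_prod (I : Type) (r : seq I) (P : pred I) (D : I -> nat) F :
  (forall i, P i -> bihomog (D i) (F i)) ->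
  bihomog (\sum_(i <- r | P i) D i) (\prod_(i <- r | P i) F i).
Proof.
move=> hF; elim/big_rec2: _ => [|i E x Pi hx]; first exact: bihomog1.
by apply: bihomogM => //; apply: hF.
Qed.

Lemma bihomogX k D Q : bihomog D Q -> bihomog (k * D) (Q ^+ k).
Proof.
move=> hQ; elim: k => [|k IH]; first by rewrite expr0 mul0n; exact: bihomog1.
by rewrite exprS mulSn; apply: bihomogM.
Qed.

Lemma bihomog_varX k : bihomog 1 (varX R k).
Proof.
move=> b a; rewrite /varX mcoeffC; case: (b =P 0%MM) => [->|_]; last first.
  by rewrite mulr0 mcoeff0 eqxx.
rewrite mulr1 mcoeffX; case: (_ =P a) => [<-|_]; last by rewrite eqxx.
by rewrite mdeg1 mdeg0.
Qed.

Lemma bihomog_varY k : bihomog 1 (varY R k).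
Proof.
move=> b a; rewrite /varY mcoeffX; case: (_ =P b) => [<-|_]; last first.
  by rewrite mcoeff0 eqxx.
rewrite mcoeff1; case: (a =P 0%MM) => [->|_]; last by rewrite eqxx.
by rewrite mdeg1 mdeg0.
Qed.

Lemma bihomog_det m (D : nat) (M : 'M[{mpoly {mpoly R[n]}[n]}]_m) :
  (forall i j, bihomog D (M i j)) -> bihomog (m * D) (\det M).
Proof.
move=> hM; apply: bihomog_sum => s _.
have H : bihomog (m * D) (\prod_i M i (s i)).
  have -> : (m * D = \sum_(i < m) D)%N by rewrite sum_nat_const card_ord.
  exact: bihomog_prod.
by case: (odd_perm s); rewrite (expr0, expr1) ?mulN1r ?mul1r //; apply: bihomogN.
Qed.

(** The quotients such as Delta_ij are homogeneous: the one written down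
    explicitly is, and division by X_j - Y_j is unique. *)
Lemma hybrid_quotient_bihomog D p (j : 'I_n) Q : p \is D.-homog ->
  hybrid j p - hybrid j.+1 p = Q * (varX R j - varY R j) -> bihomog D.-1 Q.
Proof.
move=> hp HQ.
pose h (k : nat) (i : 'I_n) := if (i < k)%N then varY R i else varX R i.
pose q (m : 'X_{1..n}) := (\prod_(i < n | i != j) h j i ^+ m i) *
  \sum_(e < m j) varX R j ^+ ((m j).-1 - e) * varY R j ^+ e.
have Eq : hybrid j p - hybrid j.+1 p =
    (\sum_(m <- msupp p) ((p@_m)%:MP)%:MP * q m) * (varX R j - varY R j).
  have E k : hybrid k p = \sum_(m <- msupp p) ((p@_m)%:MP)%:MP * mmap1 (h k) m by [].
  rewrite !E -sumrB mulr_suml; apply: eq_bigr => m _.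
  rewrite -mulrBr -mulrA; congr (_ * _).
  rewrite /mmap1 (bigD1 j) //= [X in _ - X](bigD1 j) //=.
  rewrite [X in _ - _ * X](eq_bigr (fun i => h j i ^+ m i)); last first.
    move=> i ij; congr (_ ^+ _); rewrite /h ltnS leq_eqVlt.
    by rewrite (_ : (i == j :> nat) = false) //; apply/negbTE.
  rewrite -mulrBl {1 2}/h ltnn ltnSn subrXX [LHS]mulrC /q -[RHS]mulrA.
  by congr (_ * _); exact: mulrC.
have -> : Q = \sum_(m <- msupp p) ((p@_m)%:MP)%:MP * q m.
  by apply: (mulIf (varXY_neq0 R j)); rewrite -HQ Eq.
rewrite big_seq; apply: bihomog_sum => m /(dhomogP _ _ _ hp) /= mD.
rewrite -[D.-1]add0n; apply: bihomogM; first exact: bihomogC.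
rewrite /q big_distrr /=; apply: bihomog_sum => e _.
(* Each term has degree D - 1: the factor (X_j)^(m j) - (Y_j)^(m j) of degree m j
   has been replaced by its quotient, of degree m j - 1. *)
have -> : D.-1 = (\sum_(i < n | i != j) m i * 1 + (((m j).-1 - e) * 1 + e * 1))%N.
  have := ltn_ord e; rewrite -mD mdegE (bigD1 j) //= => lte.
  under [in RHS]eq_bigr do rewrite muln1.
  move: (\sum_(i < n | i != j) m i)%N => s; lia.
apply: bihomogM; last first.
  apply: bihomogM; apply: bihomogX; first exact: bihomog_varX.
  exact: bihomog_varY.
apply: bihomog_prod => i _; apply: bihomogX; rewrite /h.
by case: ifP => _; [exact: bihomog_varY|exact: bihomog_varX].
Qed.

Lemma bihomog_coef D Q b e : bihomog D Q -> (e + mdeg b = D)%N ->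
  Q@_b \is e.-homog.
Proof.
move=> hQ De; apply/dhomogP => a /=; rewrite mcoeff_msupp => /hQ.
lia.
Qed.
End Bihomogeneous.

(** * Dehomogenization *)

Section Dehomogenization.
Variable R : idomainType.
Implicit Types (p : {mpoly R[2]}) (P : {mpoly R[3]}).

(** The exponents of X_1 and X_2. *)
Definition dehom_mon (m : 'X_{1..3}) : 'X_{1..2} :=
  [multinom m (inord i) | i < 2].

(** The monomial X^b X_3^k.  Note that homog_mon D b is mon3 b (D - mdeg b). *)
Definition mon3 (b : 'X_{1..2}) (k : nat) : 'X_{1..3} :=
  [multinom of [:: b ord0; b ord_max; k]].

Lemma mon2P (a b : 'X_{1..2}) : a ord0 = b ord0 -> a ord_max = b ord_max -> a = b.
Proof.
move=> e0 e1; apply/mnmP => -[[|[|i]] Hi] //.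
- by rewrite (_ : Ordinal Hi = ord0) //; apply/val_inj.
- by rewrite (_ : Ordinal Hi = ord_max) //; apply/val_inj.
Qed.

Lemma mon3E b k : (mon3 b k (inord 0) = b ord0) * (mon3 b k (inord 1) = b ord_max)
  * (mon3 b k (inord 2) = k).
Proof. by rewrite /mon3 !multinomE !(tnth_nth 0%N) /= !inordK. Qed.

Lemma mon3P (a b : 'X_{1..3}) : (forall i, (i < 3)%N -> a (inord i) = b (inord i)) -> a = b.
Proof. by move=> H; apply/mnmP => i; rewrite -(inord_val i) H. Qed.

Lemma dehom_mon3 b k : dehom_mon (mon3 b k) = b.
Proof.
by apply: mon2P; rewrite mnmE mon3E.
Qed.

Lemma mon3_dehom m : mon3 (dehom_mon m) (m (inord 2)) = m.
Proof.
by apply: mon3P => -[|[|[|i]]] // _; rewrite mon3E ?mnmE.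
Qed.

Lemma mdeg2 (b : 'X_{1..2}) : mdeg b = (b ord0 + b ord_max)%N.
Proof.
by rewrite mdegE big_ord_recl big_ord1; congr (_ + b _)%N; apply/val_inj.
Qed.

Lemma mdeg3 b k : mdeg (mon3 b k) = (mdeg b + k)%N.
Proof.
rewrite mdegE !big_ord_recl big_ord0 /mon3 !multinomE !(tnth_nth 0%N) /=.
by rewrite mdeg2 /bump /=; lia.
Qed.

Lemma mdeg_homog_mon D m : (mdeg m <= D)%N -> mdeg (homog_mon D m) = D.
Proof. by move=> mD; rewrite (mdeg3 m (D - mdeg m)) subnKC. Qed.

Lemma homog_mon_dehom m : homog_mon (mdeg m) (dehom_mon m) = m.
Proof.
rewrite -[RHS]mon3_dehom; congr mon3.
by rewrite -{1}[m]mon3_dehom mdeg3 addKn.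
Qed.

(** The values given to X_1, X_2, X_3 by dehomogenization: X_1, X_2 and 1. *)
Definition dehom_var (i : 'I_3) : {mpoly R[2]} :=
  if (i < 2)%N then 'X_(inord i) else 1.

(** Dehomogenization: the evaluation at X_3 = 1. *)
Definition dehomp : {mpoly R[3]} -> {mpoly R[2]} := mmap (@mpolyC 2 R) dehom_var.
HB.instance Definition _ :=
  GRing.RMorphism.copy dehomp (mmap (@mpolyC 2 R) dehom_var).

Lemma mmap1_ord3 (S : comNzRingType) (h : 'I_3 -> S) (m : 'X_{1..3}) :
  mmap1 h m = h (inord 0) ^+ m (inord 0) * h (inord 1) ^+ m (inord 1)
    * h (inord 2) ^+ m (inord 2).
Proof.
rewrite /mmap1 !big_ord_recl big_ord0 mulr1 mulrA.
by congr (h _ ^+ m _ * h _ ^+ m _ * h _ ^+ m _); apply/val_inj; rewrite /= inordK.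
Qed.

Lemma mmap1_ord2 (S : comNzRingType) (h : 'I_2 -> S) (m : 'X_{1..2}) :
  mmap1 h m = h ord0 ^+ m ord0 * h ord_max ^+ m ord_max.
Proof.
rewrite /mmap1 !big_ord_recl big_ord0 mulr1.
by congr (_ * h _ ^+ m _); apply/val_inj.
Qed.

Lemma dehomX m : dehomp 'X_[m] = 'X_[dehom_mon m].
Proof.
rewrite /dehomp mmapX mmap1_ord3 /dehom_var !inordK //= expr1n mulr1.
rewrite -[RHS]mmap1_id mmap1_ord2 !mnmE.
by congr ('X_ _ ^+ _ * 'X_ _ ^+ _); apply/val_inj; rewrite /= inordK.
Qed.

Lemma dehomZ c P : dehomp (c *: P) = c *: dehomp P.
Proof. by rewrite /dehomp mmapZ mul_mpolyC. Qed.

Lemma dehompE P : dehomp P = \sum_(m <- msupp P) P@_m *: 'X_[dehom_mon m].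
Proof.
rewrite {1}[P]mpolyE (raddf_sum dehomp); apply: eq_bigr => m _.
by rewrite /= dehomZ dehomX.
Qed.

(** Two distinct monomials of degree D remain distinct at X_3 = 1, so that
    dehomogenization loses no coefficient of a homogeneous polynomial. *)
Lemma dehom_coef D P m : P \is D.-homog -> (mdeg m <= D)%N ->
  (dehomp P)@_m = P@_(homog_mon D m).
Proof.
move=> hP mD; rewrite dehompE [in RHS](mpolyE P) !raddf_sum /=.
rewrite big_seq [RHS]big_seq; apply: eq_bigr => m' /(dhomogP _ _ _ hP) /= dm'.
rewrite !mcoeffZ !mcoeffX; congr (_ * _%:R).
congr nat_of_bool; apply/eqP/eqP => [<-|->]; first by rewrite -dm' homog_mon_dehom.
exact: dehom_mon3.
Qed.

Lemma dehom_homogenize d p : dehomp (homogenize d p) = p.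
Proof.
rewrite /homogenize (raddf_sum dehomp) [RHS]mpolyE; apply: eq_bigr => m _.
by rewrite /= dehomZ dehomX dehom_mon3.
Qed.

Lemma homogenize_homog d p : (msize p <= d.+1)%N -> homogenize d p \is d.-homog.
Proof.
move=> sp; rewrite /homogenize big_seq; apply: rpred_sum => m mp.
rewrite rpredZ // dhomogX /= mdeg_homog_mon //.
by have := msize_mdeg_lt mp; lia.
Qed.
End Dehomogenization.

(** * Evaluation at X_3 = 1 of polynomials in (X, Y) *)

Section Hybrids.
Variable R : idomainType.

(** The values given to the X_k by hybrid: Y_k for the j first variables, and
    X_k for the others. *)
Definition hybrid_var n (j : nat) (k : 'I_n) : {mpoly {mpoly R[n]}[n]} :=
  if (k < j)%N then varY R k else varX R k.

HB.instance Definition _ n (j : nat) :=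
  GRing.RMorphism.copy (@hybrid R n j)
    (mmap (@mpolyC n {mpoly R[n]} \o @mpolyC n R)
       (@hybrid_var n j)).

Lemma hybridZX n j c (m : 'X_{1..n}) : hybrid j (c *: 'X_[m]) =
  (c%:MP)%:MP * mmap1 (@hybrid_var n j) m.
Proof.
transitivity (hybrid j (c%:MP * 'X_[m])); first by rewrite mul_mpolyC.
rewrite rmorphM /=; congr (_ * _).
  exact: (mmapC _ (@mpolyC n {mpoly R[n]} \o @mpolyC n R)).
exact: (mmapX _ (@mpolyC n {mpoly R[n]} \o @mpolyC n R)).
Qed.

(** When all variables are replaced, hybrid n P is P(Y). *)
Lemma coef_hybrid_full n (P : {mpoly R[n]}) g : (hybrid n P)@_g = (P@_g)%:MP.
Proof.
rewrite [in RHS](mpolyE P) [in LHS](mpolyE P) (raddf_sum (hybrid n)) !raddf_sum /=.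
apply: eq_bigr => m _; rewrite hybridZX.
rewrite (mmap1_eq (f2 := fun k => 'X_k)) => [|k]; last by rewrite /hybrid_var ltn_ord.
rewrite mmap1_id mcoeffCM mcoeffX mcoeffZ mcoeffX mpolyCM.
by congr (_ * _); case: eqP => _; rewrite ?mpolyC0 ?mpolyC1.
Qed.

Local Notation C := {mpoly R[2]}.

(** The evaluation at X_3 = 1 of a polynomial in X_1, X_2, X_3, Y_1, Y_2, Y_3;
    Y_3 is kept. *)
Definition dehY : {mpoly {mpoly R[3]}[3]} -> {mpoly C[3]} := map_mpoly (@dehomp R).
HB.instance Definition _ := GRing.RMorphism.copy dehY (map_mpoly (@dehomp R)).

(** A polynomial in X_1, X_2, Y_1, Y_2 seen as a polynomial in X_1, X_2,
    Y_1, Y_2, Y_3. *)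
Definition liftY : {mpoly C[2]} -> {mpoly C[3]} :=
  mmap (@mpolyC 3 C) (fun i : 'I_2 => 'X_(inord i)).
HB.instance Definition _ := GRing.RMorphism.copy liftY
  (mmap (@mpolyC 3 C) (fun i : 'I_2 => 'X_(inord i))).

Lemma liftYE (Q : {mpoly C[2]}) :
  liftY Q = \sum_(m <- msupp Q) Q@_m *: 'X_[mon3 m 0].
Proof.
rewrite /liftY; apply: eq_bigr => m _; rewrite mul_mpolyC; congr (_ *: _).
rewrite mmap1_ord2 -[RHS]mmap1_id mmap1_ord3 !mon3E expr0 mulr1.
by congr ('X_ _ ^+ _ * 'X_ _ ^+ _).
Qed.

Lemma coef_liftY (Q : {mpoly C[2]}) b k :
  (liftY Q)@_(mon3 b k) = if k == 0%N then Q@_b else 0.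
Proof.
rewrite liftYE [in RHS](mpolyE Q) !raddf_sum /=.
case: k => [|k] /=; last first.
  rewrite big1 // => m _; rewrite mcoeffZ mcoeffX.
  case: eqP => [E|_]; last by rewrite mulr0.
  by move: (congr1 (fun m : 'X_{1..3} => m (inord 2)) E); rewrite !mon3E.
apply: eq_bigr => m _; rewrite !mcoeffZ !mcoeffX; congr (_ * (nat_of_bool _)%:R).
by apply/eqP/eqP => [E|->] //; rewrite -(dehom_mon3 m 0) E dehom_mon3.
Qed.

Lemma dehom_varE (i : 'I_3) : dehomp 'X_i = dehom_var R i.
Proof. by rewrite /dehomp mmapX mmap1U. Qed.

Lemma dehY_varX i : dehY (varX R i) = (dehom_var R i)%:MP.
Proof. by rewrite /dehY /varX map_mpolyC /= dehom_varE. Qed.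

Lemma dehY_varY i : dehY (varY R i) = 'X_i.
Proof. exact: map_mpolyX. Qed.

Lemma dehomC c : dehomp c%:MP = c%:MP :> C.
Proof. exact: mmapC. Qed.

Lemma liftY_varX (k : nat) : (k < 2)%N ->
  liftY (varX R (inord k)) = (dehom_var R (inord k))%:MP.
Proof.
move=> k2; rewrite /liftY /varX mmapC /dehom_var inordK ?k2 //.
exact: ltnW.
Qed.

Lemma liftY_varY (k : nat) : (k < 2)%N -> liftY (varY R (inord k)) = 'X_(inord k).
Proof. by move=> k2; rewrite /liftY mmapX mmap1U inordK. Qed.

Lemma rmorph_mmap1 (S S' : comNzRingType) (f : {rmorphism S -> S'}) n
    (h : 'I_n -> S) m : f (mmap1 h m) = mmap1 (f \o h) m.
Proof.
by rewrite /mmap1 rmorph_prod; apply: eq_bigr => i _; rewrite rmorphXn.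
Qed.

Lemma mmap1_homog_mon (S : comNzRingType) (h : 'I_3 -> S) (g : 'I_2 -> S) d m :
  h (inord 0) = g ord0 -> h (inord 1) = g ord_max -> h (inord 2) = 1 ->
  mmap1 h (homog_mon d m) = mmap1 g m.
Proof. by move=> h0 h1 h2; rewrite mmap1_ord2 mmap1_ord3 !mon3E h0 h1 h2 expr1n mulr1. Qed.

(** The rows H_0, H_1, H_2 become the affine ones at X_3 = 1, because in them
    the homogenizing variable is still X_3 and not Y_3. *)
Lemma dehY_hybrid d j (p : C) : (j <= 2)%N ->
  dehY (hybrid j (homogenize d p)) = liftY (hybrid j p).
Proof.
move=> j2; rewrite [in RHS](mpolyE p) /homogenize !(raddf_sum (hybrid j)).
rewrite (raddf_sum dehY) (raddf_sum liftY) /=.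
apply: eq_bigr => m _; rewrite !hybridZX (rmorphM dehY) (rmorphM liftY) /=.
congr (_ * _).
  by rewrite /dehY /liftY map_mpolyC /= dehomC mmapC.
rewrite (rmorph_mmap1 dehY) (rmorph_mmap1 liftY).
have E k : (k < 2)%N ->
    (dehY \o @hybrid_var 3 j) (inord k) = (liftY \o @hybrid_var 2 j) (inord k).
  move=> k2; have k3 : (k < 3)%N by apply: ltnW.
  rewrite /= /hybrid_var !inordK //; case: ifP => _.
    by rewrite dehY_varY liftY_varY.
  by rewrite dehY_varX liftY_varX.
have i0 : inord 0 = ord0 :> 'I_2 by apply/val_inj; rewrite /= inordK.
have i1 : inord 1 = ord_max :> 'I_2 by apply/val_inj; rewrite /= inordK.
apply: mmap1_homog_mon.
- by rewrite -i0; exact: E.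
- by rewrite -i1; exact: E.
by rewrite /= /hybrid_var inordK // ltnNge j2 dehY_varX /dehom_var inordK // mpolyC1.
Qed.

(** The row H_3 = F(Y) has no term of degree less than d in Y. *)
Lemma coef_dehY_hybrid3 d (p : C) g : (msize p <= d.+1)%N -> (mdeg g < d)%N ->
  (dehY (hybrid 3 (homogenize d p)))@_g = 0.
Proof.
move=> sp gd; rewrite /dehY mcoeff_map_mpoly coef_hybrid_full /= dehomC.
rewrite (dhomog_nemf_coeff (homogenize_homog sp)) ?mpolyC0 //=.
by rewrite neq_ltn gd.
Qed.
End Hybrids.

Lemma eq_det (S : pzRingType) n (E F : 'I_n -> 'I_n -> S) : E =2 F ->
  \det (\matrix_(i, j) E i j) = \det (\matrix_(i, j) F i j).
Proof.
by move=> EF; congr (\det _); apply/matrixP => i j; rewrite !mxE EF.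
Qed.

Lemma rmorph_det (S S' : pzRingType) (f : {rmorphism S -> S'}) n
    (E : 'I_n -> 'I_n -> S) :
  f (\det (\matrix_(i, j) E i j)) = \det (\matrix_(i, j) f (E i j)).
Proof.
by rewrite -det_map_mx; congr (\det _); apply/matrixP => i j; rewrite !mxE.
Qed.

Lemma ord3_cases (T : Type) (f : 'I_3 -> T) (j : 'I_3) :
  (if (j == 0 :> nat) then f ord0 else if (j == 1 :> nat) then f (inord 1)
   else f (inord 2)) = f j.
Proof.
by case: j => -[|[|[|j]]] Hj //=; congr f; apply/val_inj; rewrite /= ?inordK.
Qed.

(** Additivity of the determinant in its last row, the part that comes from h
    being expanded along that row: the e i are cofactors.  The determinant of
    a, b, c is written with these as columns, as in the definition of Delta. *)
Lemma det3_split (S : comNzRingType) (a b c h : 'I_3 -> S) (h2 : 'I_3 -> S) u :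
  (forall i, h2 i = h i + c i * u) ->
  exists e : 'I_3 -> S,
  \det (\matrix_(r < 3, i < 3) if (r == 0 :> nat) then a i
     else if (r == 1 :> nat) then b i else h2 i) =
  \det (\matrix_(i < 3, j < 3) if (j == 0 :> nat) then a i
     else if (j == 1 :> nat) then b i else c i) * u + \sum_i e i * h i.
Proof.
move=> H.
exists (cofactor (\matrix_(r < 3, i < 3) if (r == 0 :> nat) then a i
     else if (r == 1 :> nat) then b i else h2 i) ord_max).
rewrite -[X in _ = X * u + _]det_tr.
rewrite !(expand_det_row _ ord_max) mulr_suml -big_split /=; apply: eq_bigr => i _.
rewrite !mxE /= H mulrDl addrC mulrAC; congr (_ + _); first exact: mulrC.
congr (_ * _ * _); congr (_ * \det _); apply/matrixP => r s; rewrite !mxE.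
by case: r => -[|[|r]] Hr.
Qed.

(** If H_{j-1} = H_j + u_j a_j for j = 1, 2, 3 and B is the quotient of
    det (H_0, H_1, H_2) by u_1 u_2, then B is equal to u_3 det (a_1, a_2, a_3)
    modulo the ideal generated by the entries of H_3.  (Indices of a and u are
    shifted by one below.) *)
Lemma det3_exchange (S : idomainType) (H : nat -> 'I_3 -> S)
    (a : 'I_3 -> 'I_3 -> S) (u : 'I_3 -> S) (B : S) :
  (forall r (j : 'I_3) i, r = j :> nat -> H r i = H r.+1 i + a j i * u j) ->
  u (inord 0) * u (inord 1) != 0 ->
  \det (\matrix_(r < 3, i < 3) H r i) = B * (u (inord 0) * u (inord 1)) ->
  exists e : 'I_3 -> S,
    B = \det (\matrix_(i < 3, j < 3) a j i) * u (inord 2) + \sum_i e i * H 3 i.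
Proof.
move=> Ha u0; have Hk k : (k < 3)%N ->
    forall i, H k i = H k.+1 i + a (inord k) i * u (inord k).
  by move=> k3 i; rewrite -Ha // inordK.
rewrite (det3_telescope (Hk 0%N isT) (Hk 1%N isT)) -mulrA => /(mulIf u0) <-.
have [e ->] := det3_split (a (inord 0)) (a (inord 1)) (Hk 2%N isT).
exists e; congr (\det _ * _ + _); apply/matrixP => i j; rewrite !mxE.
have -> : inord 0 = ord0 :> 'I_3 by apply/val_inj; rewrite /= inordK.
exact: (ord3_cases (a^~ i)).
Qed.

(** * Comparison of Delta with Bez *)

Section DeltaBez.
(* B and the D i j stand for Bez and the Delta_ij of arbitrary f_i of degree at
   most d. *)
Variables (R : idomainType) (d : nat) (f : 'I_3 -> {mpoly R[2]}).
Variables (B : {mpoly {mpoly R[2]}[2]}) (D : 'I_3 -> 'I_3 -> {mpoly {mpoly R[3]}[3]}).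
Hypothesis sf : forall i, (msize (f i) <= d.+1)%N.
Let F i := homogenize d (f i).
Hypothesis BE : \det (\matrix_(r < 3, i < 3) hybrid r (f i)) =
  B * \prod_(k < 2) (varX R k - varY R k).
Hypothesis DE : forall i j : 'I_3,
  hybrid j (F i) - hybrid j.+1 (F i) = D i j * (varX R j - varY R j).
Local Notation C := {mpoly R[2]}.

(* X_k - Y_k at X_3 = 1 *)
Let u (k : 'I_3) : {mpoly C[3]} := (dehom_var R k)%:MP - 'X_k.

Lemma dehom_varXY_neq0 k : u k != 0.
Proof.
apply/eqP => /(congr1 (mcoeff U_(k)%MM)).
rewrite mcoeffB mcoeffC mcoeffX mcoeff0 eqxx mnm1_eq0 mulr0 sub0r => /eqP.
by rewrite oppr_eq0 oner_eq0.
Qed.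

Lemma dehom_Delta_Bez : exists e : 'I_3 -> {mpoly C[3]},
  liftY B = dehY (\det (\matrix_(i < 3, j < 3) D i j)) * (1 - 'X_(inord 2))
    + \sum_i e i * dehY (hybrid 3 (F i)).
Proof.
pose H (r : nat) i := dehY (hybrid r (F i)).
have Ha r (j : 'I_3) i : r = j :> nat ->
    H r i = H r.+1 i + dehY (D i j) * u j.
  move=> ->; apply/eqP; rewrite addrC -subr_eq /H /u -(rmorphB (@dehY _)) DE.
  by rewrite (rmorphM (@dehY _)) (rmorphB (@dehY _)) /= dehY_varX dehY_varY.
have HE : \det (\matrix_(r < 3, i < 3) H r i) =
    liftY B * (u (inord 0) * u (inord 1)).
  transitivity (liftY (\det (\matrix_(r < 3, i < 3) hybrid r (f i)))).
    rewrite (rmorph_det (@liftY _)); apply: eq_det => r i.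
    by rewrite /H dehY_hybrid // -ltnS.
  rewrite BE (rmorphM (@liftY _)) /=; congr (_ * _).
  rewrite big_ord_recl big_ord1 (rmorphM (@liftY _)) !(rmorphB (@liftY _)) /=.
  have i0 : ord0 = inord 0 :> 'I_2 by apply/val_inj; rewrite /= inordK.
  have i1 : lift ord0 ord0 = inord 1 :> 'I_2 by apply/val_inj; rewrite /= inordK.
  by rewrite i1 i0 !liftY_varX // !liftY_varY.
have [e ->] := det3_exchange Ha
  (mulf_neq0 (dehom_varXY_neq0 (inord 0)) (dehom_varXY_neq0 (inord 1))) HE.
exists e; rewrite (rmorph_det (@dehY _)).
congr (_ + _); congr (_ * _).
by rewrite /u /dehom_var inordK // mpolyC1.
Qed.

(** Below degree d in Y, Bez = Delta (1 - Y_3) at X_3 = 1; as Bez has no Y_3,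
    the coefficient of the right-hand side at Y^b Y_3^k, which is the difference
    of those of Delta at Y^b Y_3^k and Y^b Y_3^(k-1), vanishes for 0 < k. *)
Lemma dehom_coef_Delta b k : (mdeg b + k < d)%N ->
  dehomp (\det (\matrix_(i < 3, j < 3) D i j))@_(mon3 b k) = B@_b.
Proof.
have [e He] := dehom_Delta_Bez; move: (\det _) He => Delta He.
have rest g : (mdeg g < d)%N ->
    (\sum_i e i * dehY (hybrid 3 (F i)))@_g = 0.
  move=> gd; rewrite raddf_sum big1 // => i _ /=.
  rewrite mcoeffM big1 // => -[g1 g2] /= /eqP Eg.
  rewrite coef_dehY_hybrid3 ?mulr0 //; apply: leq_ltn_trans gd.
  by have := congr1 mdeg Eg; rewrite mdegD /=; lia.
have coefE g : (mdeg g < d)%N -> (liftY B)@_g =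
    dehomp Delta@_g - (dehY Delta * 'X_(inord 2))@_g.
  move=> gd; rewrite He mcoeffD rest // addr0 mulrBr mulr1 mcoeffB.
  by rewrite /dehY mcoeff_map_mpoly.
elim: k => [|k IH] bk.
  have := coefE (mon3 b 0); rewrite coef_liftY mdeg3 /= => -> //.
  suff -> : (dehY Delta * 'X_(inord 2))@_(mon3 b 0) = 0 by rewrite subr0.
  rewrite mcoeffM big1 // => -[g1 g2] /= /eqP Eg.
  rewrite mcoeffX; case: eqP => [E2|_]; last by rewrite mulr0.
  (* Y_3 does not divide Y^b. *)
  have := congr1 (fun m : 'X_{1..3} => m (inord 2)) Eg.
  by rewrite mnmDE mon3E -E2 mnm1E eqxx addn1.
have := coefE (mon3 b k.+1); rewrite coef_liftY mdeg3 /= => /(_ bk)/esym/eqP.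
rewrite subr_eq0 => /eqP ->.
have -> : mon3 b k.+1 = (U_(inord 2) + mon3 b k)%MM.
  by apply: mon3P => -[|[|[|i]]] // _; rewrite mnmDE !mon3E mnm1E -val_eqE /= !inordK.
rewrite mcoeffMX /dehY mcoeff_map_mpoly; apply: IH; lia.
Qed.

Lemma Delta_bihomog : bihomog (3 * d.-1) (\det (\matrix_(i < 3, j < 3) D i j)).
Proof.
apply: bihomog_det => i j; rewrite mxE.
exact: hybrid_quotient_bihomog (homogenize_homog (sf i)) (DE i j).
Qed.

Lemma coef_Delta b k m : (mdeg b + k = d.-1)%N -> (0 < d)%N ->
  (mdeg m <= 2 * d - 2)%N ->
  (\det (\matrix_(i < 3, j < 3) D i j))@_(mon3 b k)@_(homog_mon (2 * d - 2) m)
  = B@_b@_m.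
Proof.
move=> bk d0 md; rewrite -(@dehom_coef_Delta b k); last by lia.
rewrite (@dehom_coef _ (2 * d - 2)) //; apply: (bihomog_coef Delta_bihomog).
by rewrite mdeg3 bk; lia.
Qed.
End DeltaBez.

(** * Enumeration of the row and column indices *)

Section MonomialIndex.
Variables (u : int) (k : nat).
(* The monomials of degree less than k in X_1, X_2 are those of degree at most
   u; this forces k = 0 when u < 0. *)
Hypothesis uk : forall n : nat, (n < k)%N = (n%:Z <= u)%R.

Lemma mdeg_homog_bm (b : 'X_{1..2 < k}) : (mdeg (homog_mon `|u| b))%:Z = u.
Proof.
have := bmdeg b; rewrite uk => bu.
by rewrite mdeg_homog_mon; lia.
Qed.

Fact mon_of_bound (b : 'X_{1..2 < k}) : (mdeg (homog_mon `|u| b) < `|u|.+1)%N.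
Proof. by have := mdeg_homog_bm b; case: b => b bk /=; lia. Qed.

(** The homogenization of degree u of the monomial b. *)
Definition mon_of (b : 'X_{1..2 < k}) : mon u :=
  exist _ (BMultinom (mon_of_bound b)) (introT eqP (mdeg_homog_bm b)).

Lemma mdeg_mon_val (m : mon u) : (mdeg (mon_val m))%:Z = u.
Proof. exact/eqP/(valP m). Qed.

Lemma mon_val_homog (m : mon u) : mon_val m = homog_mon `|u| (dehom_mon (mon_val m)).
Proof. by rewrite -[LHS]homog_mon_dehom; congr homog_mon; have := mdeg_mon_val m; lia. Qed.

Lemma mdeg_dehom_mon m : (mdeg (dehom_mon m) <= mdeg m)%N.
Proof. by rewrite -{2}[m]mon3_dehom mdeg3 leq_addr. Qed.

Lemma mon_of_surj m : exists b, m = mon_of b.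
Proof.
have lt : (mdeg (dehom_mon (mon_val m)) < k)%N.
  by rewrite uk; have := mdeg_dehom_mon (mon_val m); have := mdeg_mon_val m; lia.
exists (BMultinom lt); apply/val_inj/val_inj => /=.
exact: mon_val_homog.
Qed.
End MonomialIndex.

(** An exhaustive list without repetitions of the elements of T, as a bijection
    with the ranks that index the matrices on T. *)
Lemma enum_bij (T : finType) (s : seq T) N : uniq s -> (forall x, x \in s) ->
  size s = N -> exists2 r : 'I_N -> 'I_#|T|, bijective r &
    forall i x0, enum_val (r i) = nth x0 s i.
Proof.
move=> us sT sN.
pose r (i : 'I_N) := enum_rank (tnth (in_tuple s) (cast_ord (esym sN) i)).
have rE i x0 : enum_val (r i) = nth x0 s i by rewrite /r enum_rankK (tnth_nth x0).
exists r => //; apply: inj_card_bij.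
  move=> i j /(congr1 enum_val) E; apply/val_inj/eqP => /=.
  rewrite (rE i (enum_val (r i))) (rE j (enum_val (r i))) in E.
  by rewrite -(nth_uniq (enum_val (r i)) _ _ us) ?sN ?ltn_ord ?E.
rewrite !card_ord -sN -(card_uniqP us); apply: subset_leq_card.
by apply/subsetP => x _; apply: sT.
Qed.

Lemma mnm_le_mdeg n (m : 'X_{1..n}) i : (m i <= mdeg m)%N.
Proof. by rewrite mdegE (bigD1 i) //= leq_addr. Qed.

Section Indices.
Variable d : nat.
Hypothesis d0 : (0 < d)%N.
Let t : int := (2 * d)%N%:Z - 2.

Lemma target_bound n : (n < (2 * d).-1)%N = (n%:Z <= t)%R.
Proof. by rewrite /t; lia. Qed.

Lemma dual_bound n : (n < d)%N = (n%:Z <= t3 d - t)%R.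
Proof. by rewrite /t /t3; lia. Qed.

Lemma mult_bound n : (n < d.-1)%N = (n%:Z <= t - d%:Z)%R.
Proof. by rewrite /t; lia. Qed.

(** For t = 2d - 2 the condition on exponents in S^{t,j} always holds, as the
    degree t - d is less than d. *)
Lemma smon_of_bound (x : 'I_3 * mon (t - d%:Z)) :
  [forall i : 'I_3, (i < x.1)%N ==> (mon_val x.2 i < d)%N].
Proof.
apply/forallP => i; apply/implyP => _.
have := mnm_le_mdeg (mon_val x.2) i; have := mdeg_mon_val x.2; rewrite /t; lia.
Qed.

Definition smon_of (x : 'I_3 * mon (t - d%:Z)) : smon d t :=
  exist _ x (smon_of_bound x).

(** S^{t_3-t,j} = 0, since t_3 - t - d = -1. *)
Lemma smon_empty : smon d (t3 d - t) -> False.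
Proof.
move=> [[i m] _]; have := mdeg_mon_val m; rewrite /t3 /t; lia.
Qed.

(** The indices of the homogeneous source in the order of affine_rows. *)
Definition source_seq : seq (source_index d t) :=
  [seq inr (smon_of (i, mon_of mult_bound m))
     | i <- enum 'I_3, m <- enum {: 'X_{1..2 < d.-1}}]
  ++ [seq inl (mon_of dual_bound b) | b <- enum {: 'X_{1..2 < d}}].

(** The indices of the homogeneous target in the order of affine_cols. *)
Definition target_seq : seq (target_index d t) :=
  [seq inl (mon_of target_bound b) | b <- enum {: 'X_{1..2 < (2 * d).-1}}].

Lemma source_seq_uniq : uniq source_seq.
Proof.
rewrite cat_uniq allpairs_uniq ?enum_uniq //; last first.
  (* An index is recovered from the monomial in X_1, X_2; the default value (i, 0)
     is never reached. *)
  move=> [i m] [i' m'] _ _ E.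
  pose f (s : source_index d t) :=
    if s is inr x then ((val x).1, dehom_mon (mon_val (val x).2)) else (i, 0%MM).
  by move: (congr1 f E); rewrite /f /= !dehom_mon3 => -[-> /val_inj ->].
rewrite map_inj_uniq ?enum_uniq ?andbT => [|b b' E].
  by apply/hasPn => s /mapP[b _ ->]; apply/negP => /allpairsP[? []].
pose f (s : source_index d t) :=
  if s is inl m then dehom_mon (mon_val m) else 0%MM.
by move: (congr1 f E); rewrite /f /= !dehom_mon3 => /val_inj.
Qed.

Lemma mem_source_seq s : s \in source_seq.
Proof.
rewrite mem_cat; case: s => [m|[[i m] P]].
  have [b ->] := mon_of_surj dual_bound m.
  by rewrite map_f ?mem_enum // orbT.
have [b E] := mon_of_surj mult_bound m; apply/orP; left.
apply/allpairsP; exists (i, b); rewrite !mem_enum; split=> //.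
by congr inr; apply/val_inj; rewrite /= E.
Qed.

Lemma target_seq_uniq : uniq target_seq.
Proof.
rewrite map_inj_uniq ?enum_uniq // => b b' E.
pose f (s : target_index d t) :=
  if s is inl m then dehom_mon (mon_val m) else 0%MM.
by move: (congr1 f E); rewrite /f /= !dehom_mon3 => /val_inj.
Qed.

Lemma mem_target_seq s : s \in target_seq.
Proof.
case: s => [m|x]; last by case: (smon_empty x).
have [b ->] := mon_of_surj target_bound m.
by rewrite map_f ?mem_enum.
Qed.

(** The row of the affine Dixon matrix that corresponds to a source index. *)
Definition affine_row (s : source_index d t) : {mpoly (genA d)[2]} :=
  match s with
  | inl m => (Bez d)@_(dehom_mon (mon_val m))
  | inr x => 'X_[dehom_mon (mon_val (val x).2)] * gen_f d (val x).1
  end.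

(** The monomial that corresponds to a target index; the second case does not
    occur, by smon_empty. *)
Definition affine_col (s : target_index d t) : 'X_{1..2} :=
  if s is inl m then dehom_mon (mon_val m) else 0%MM.

Lemma affine_rowsE : affine_rows d = map affine_row source_seq.
Proof.
rewrite /affine_rows /source_seq (map_cat affine_row) map_allpairs.
apply: congr2; first by apply: eq_allpairs => i m /=; rewrite dehom_mon3.
by rewrite -[RHS]map_comp; apply: eq_map => b /=; rewrite dehom_mon3.
Qed.

Lemma affine_colsE : affine_cols d = map affine_col target_seq.
Proof.
by rewrite /affine_cols -[RHS]map_comp; apply: eq_map => b /=; rewrite dehom_mon3.
Qed.
End Indices.

(** * Entries of the two matrices *)

Section Entries.
Variable d : nat.
Hypothesis d0 : (0 < d)%N.
Let t : int := (2 * d)%N%:Z - 2.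

Lemma msize_gen_f i : (msize (gen_f d i) <= d.+1)%N.
Proof.
apply/(leq_trans (msize_sum _ _ _))/bigmax_leqP => m _.
by apply/(leq_trans (msizeZ_le _ _)); rewrite msizeX; have := bmdeg m.
Qed.

Lemma coef_gen_Delta b k m : (mdeg b + k = d.-1)%N -> (mdeg m <= 2 * d - 2)%N ->
  (Delta d)@_(mon3 b k)@_(homog_mon (2 * d - 2) m) = (Bez d)@_b@_m.
Proof.
move=> bk md.
exact: (coef_Delta msize_gen_f (BezE d) (@Delta_ijE d) bk d0 md).
Qed.

Lemma psi1_0 u : psi1 ([ffun=> 0] : dualS d (t3 d - u)) = 0.
Proof. by rewrite /psi1 big1 // => m _; rewrite ffunE scale0r. Qed.

Lemma psi1_delta u (m : mon (t3 d - u)) :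
  psi1 (delta_fun d m : dualS d (t3 d - u)) = (Delta d)@_(mon_val m).
Proof.
rewrite /psi1 (bigD1 m) //= big1 ?addr0 => [|m' nm]; rewrite ffunE.
  by rewrite eqxx scale1r.
by rewrite (negbTE nm) scale0r.
Qed.

Lemma psi2_0 u : psi2 ([ffun=> 0] : sumS d u) = 0.
Proof.
rewrite /psi2 big1 // => j _; rewrite /component big1 ?mul0r // => x _.
by rewrite ffunE scale0r.
Qed.

Lemma psi2_delta u (x : smon d u) :
  psi2 (delta_fun d x : sumS d u) =
  'X_[mon_val (val x).2] * gen_F d (val x).1.
Proof.
rewrite /psi2 (bigD1 (val x).1) //= [X in _ + X]big1 ?addr0 => [|j nj].
  congr (_ * _); rewrite /component (bigD1 x) //= big1 ?addr0 => [|y /andP[_ ny]].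
    by rewrite ffunE eqxx scale1r.
  by rewrite ffunE (negbTE ny) scale0r.
rewrite /component big1 ?mul0r // => y /eqP yj; rewrite ffunE.
case: eqP => [E|_]; last by rewrite scale0r.
by rewrite -yj E eqxx in nj.
Qed.

Lemma target_coordE (s : source_index d t) (m : mon t) :
  target_coord (Psi (source_basis s)) (inl m : target_index d t) =
  (affine_row s)@_(dehom_mon (mon_val m)).
Proof.
have tE : `|t|%N = (2 * d - 2)%N by rewrite /t; lia.
have md : (mdeg (dehom_mon (mon_val m)) <= 2 * d - 2)%N.
  by have := mdeg_dehom_mon (mon_val m); have := mdeg_mon_val m; rewrite /t; lia.
have -> : target_coord (Psi (source_basis s)) (inl m : target_index d t) =
  (Psi (source_basis s)).1@_(homog_mon (2 * d - 2) (dehom_mon (mon_val m))).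
  by rewrite -tE -mon_val_homog.
case: s => [m0|x] /=.
  rewrite psi1_delta psi2_0 addr0 -{1}(mon3_dehom (mon_val m0)) coef_gen_Delta //.
  by have := mdeg_mon_val m0; rewrite -{1}(mon3_dehom (mon_val m0)) mdeg3 /t3 /t; lia.
rewrite psi1_0 psi2_delta add0r -(@dehom_coef _ (2 * d - 2)) //.
  rewrite (rmorphM (@dehomp _)) /= dehomX; congr ((_ * _)@__).
  exact: dehom_homogenize.
have -> : (2 * d - 2 = mdeg (mon_val (val x).2) + d)%N.
  by have := mdeg_mon_val (val x).2; rewrite /t; lia.
by apply: dhomogM; rewrite ?dhomogX //; apply/homogenize_homog/msize_gen_f.
Qed.
End Entries.

Theorem proposition6p1 (d : nat) (d_ge1 : (1 <= d)%N) :
  let t : int := (2 * d)%N%:Z - 2 in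
  exists (r : 'I_(2 * d ^ 2 - d)%N -> 'I_#|source_index d t|)
         (c : 'I_(2 * d ^ 2 - d)%N -> 'I_#|target_index d t|),
    [/\ bijective r,
        bijective c,
        forall k : 'I_(2 * d ^ 2 - d)%N,
          exists2 m : mon t,
            enum_val (c k) = inl m
            & mon_val m = homog_mon (2 * d - 2)%N (nth 0%MM (affine_cols d) k)
      & affine_dixon_mx d = mxsub r c (homog_mx d t)^T].
Proof.
move=> t.
have sr : size (source_seq d_ge1) = (2 * d ^ 2 - d)%N.
  by rewrite -(size_affine_rows d_ge1) (affine_rowsE d_ge1) size_map.
have sc : size (target_seq d_ge1) = (2 * d ^ 2 - d)%N.
  by rewrite -(size_affine_cols d_ge1) (affine_colsE d_ge1) size_map.
have [r bij_r rE] := enum_bij (source_seq_uniq d_ge1) (mem_source_seq d_ge1) sr.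
have [c bij_c cE] := enum_bij (target_seq_uniq d_ge1) (mem_target_seq d_ge1) sc.
have rowE (k : 'I_(2 * d ^ 2 - d)) : nth 0 (affine_rows d) k = affine_row (enum_val (r k)).
  by rewrite (affine_rowsE d_ge1) (nth_map (enum_val (r k))) ?sr ?ltn_ord // -rE.
have colE (k : 'I_(2 * d ^ 2 - d)) : exists2 m : mon t, enum_val (c k) = inl m &
    nth 0%MM (affine_cols d) k = dehom_mon (mon_val m).
  rewrite (affine_colsE d_ge1) (nth_map (enum_val (c k))) ?sc ?ltn_ord // -cE.
  by case: (enum_val _) => [m|/(smon_empty d_ge1)[]]; exists m.
exists r, c; split=> // [k|].
  have [m Em ->] := colE k; exists m => //.
  rewrite [LHS]mon_val_homog; congr homog_mon; rewrite /t; lia.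
apply/matrixP => i j; rewrite [LHS]mxE [RHS]mxE [RHS]mxE [RHS]mxE rowE.
have [m -> ->] := colE j.
by rewrite target_coordE.
Qed.
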